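(* Let $A$ be a twisted axis-aligned $2n$-gon with $A_{i+2n}=\phi(A_i)$ for all $i$, where the projective transformation $\phi$ fixes every point at infinity. Assume $A$ is generic in the sense that $T^{n-1}(A)$ is defined and no three consecutive vertices of $T^{n-1}(A)$ are collinear. Then, writing $B=T^{n-1}(A)$, for each index $i_0$ of $B$ the vertices $B_{i_0+2m}$ ($m\in\mathbb{Z}$) all lie on one line; that is, the odd vertices of $B$ are collinear, as are its even vertices.
   Context: A twisted polygon is a sequence $(A_i)$ of points of the real projective plane, indexed by $\mathbb{Z}$ or $\frac12+\mathbb{Z}$, with $A_{i+N}=\phi(A_i)$ for a projective transformation $\phi$. $A$ (indexed by $\mathbb{Z}$) is axis-aligned if its points lie in the affine plane $\mathbb{R}^2\subset\mathbb{RP}^2$ and its sides $A_iA_{i+1}$ are alternately parallel to the $x$-axis and the $y$-axis. The pentagram map sends $A$ to $B=T(A)$, indexed by the other coset, with $B_i=\overleftrightarrow{A_{i-3/2}A_{i+1/2}}\cap\overleftrightarrow{A_{i-1/2}A_{i+3/2}}$ ($\overleftrightarrow{PQ}$ the line through $P,Q$); $T^{k}$ is the $k$-fold iterate. *)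

(* Defs.v *)
From mathcomp Require Import all_boot all_order all_algebra.
From mathcomp Require Import reals.

Set Implicit Arguments.
Unset Strict Implicit.
Unset Printing Implicit Defensive.

Import GRing.Theory.
Local Open Scope ring_scope.

(* Points and lines of RP^2 are the subspaces of R^3 of dimension 1 and 2, so
   that incidence is inclusion and equality of points is Leibniz equality.
   (P + Q)%VS is the line through P and Q only if P and Q are distinct points,
   and (L :&: M)%VS is a point only if L and M are distinct lines. *)
Notation subspace R := ({vspace 'rV[R]_3}) (only parsing).

Section ProjectivePlane.
Variable R : realType.
Implicit Types (P Q L M : subspace R).

Definition is_point P : Prop := \dim P = 1%N.
Definition is_line L : Prop := \dim L = 2%N.

Definition join_line P Q : subspace R := (P + Q)%VS.
Definition meet_point L M : subspace R := (L :&: M)%VS.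

Definition collinear (I : Type) (P : I -> subspace R) : Prop :=
  exists2 L : subspace R, is_line L & forall k : I, (P k <= L)%VS.

(* [x : y : z] *)
Definition hpoint (x y z : R) : subspace R :=
  <[\row_(j < 3) [:: x; y; z]`_j]>%VS.

Definition affine_point (x y : R) : subspace R := hpoint x y 1.
Definition is_affine P : Prop := exists x y : R, P = affine_point x y.

Definition line_at_infinity : subspace R :=
  join_line (hpoint 1 0 0) (hpoint 0 1 0).
Definition x_axis : subspace R :=
  join_line (affine_point 0 0) (affine_point 1 0).
Definition y_axis : subspace R :=
  join_line (affine_point 0 0) (affine_point 0 1).

(* Meant for lines other than the line at infinity; a line is parallel to
   itself. *)
Definition parallel L M : Prop :=
  meet_point L line_at_infinity = meet_point M line_at_infinity.

(* The projective transformation induced by phi is P |-> (phi @: P)%VS. *)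
Definition is_projective (phi : 'End('rV[R]_3)) : Prop := lker phi = 0%VS.

Definition fixes_infinity (phi : 'End('rV[R]_3)) : Prop :=
  forall P, is_point P -> (P <= line_at_infinity)%VS -> (phi @: P)%VS = P.

Implicit Type A : int -> subspace R.

Definition twisted_polygon (N : nat) (phi : 'End('rV[R]_3)) A : Prop :=
  [/\ forall i : int, is_point (A i),
      is_projective phi
    & forall i : int, A (i + N%:Z) = (phi @: A i)%VS].

(* The integer e records which of the two parities is horizontal. *)
Definition axis_aligned A : Prop :=
  [/\ forall i : int, is_affine (A i),
      forall i : int, A i <> A (i + 1)
    & exists e : int, forall m : int,
        parallel (join_line (A (e + 2 * m)) (A (e + 2 * m + 1))) x_axis /\
        parallel (join_line (A (e + 2 * m + 1)) (A (e + 2 * m + 2))) y_axis].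

(* Both cosets Z and 1/2 + Z are represented by int: if A i is the vertex of
   index i + s, then pentagram A i is the vertex B_(i + s + 1/2) of B = T(A),
   i.e. the intersection of the line through A_(i + s - 1) and A_(i + s + 1)
   with the line through A_(i + s) and A_(i + s + 2).  Hence
   iter k pentagram A i is the vertex of T^k(A) of index i + s + k/2. *)
Definition pentagram A : int -> subspace R := fun i =>
  meet_point (join_line (A (i - 1)) (A (i + 1)))
             (join_line (A i) (A (i + 2))).

Definition pentagram_defined A : Prop :=
  forall i : int,
    [/\ A (i - 1) <> A (i + 1),
        A i <> A (i + 2)
      & join_line (A (i - 1)) (A (i + 1)) <> join_line (A i) (A (i + 2))].

Definition iter_pentagram (k : nat) A : int -> subspace R :=
  iter k pentagram A.

Definition iter_pentagram_defined (k : nat) A : Prop :=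
  forall j : nat, (j < k)%N -> pentagram_defined (iter_pentagram j A).

Definition no_three_consecutive_collinear A : Prop :=
  forall i : int, ~ collinear (fun k : 'I_3 => A (i + k%:Z)).

End ProjectivePlane.

(* Main.v *)
(* Normalise the lift [f i] of the vertex [A i] to have last coordinate 1, so
   that [f (i + 1) - f i] lies on one of two fixed lines, depending on the parity
   of [i].  By induction on [k], the vertex of T^k(A) of index [i] is spanned by
   a weighted sum [\sum_(j <= k) w_j f (c + s + 2 j)], with [c = i - k], that does
   not depend on [s = 0, ..., k]; these [k] linear equations determine the [k + 1]
   weights up to a factor.  When [f (m + 2 n) = lam f m + C], the weights for the
   indices [i] and [i + 2] of T^(n-1)(A) are cyclic shifts of each other (up to
   [lam]), so that two such vertices differ by a multiple of the constant
   vector [C]: all of them lie on the line through one of them and [C]. *)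
Require Import Defs.
From mathcomp Require Import all_boot all_order all_algebra.
From mathcomp Require Import reals.
From mathcomp Require Import boolp zify.

Local Open Scope ring_scope.

Import GRing.Theory.

(** * Weighted sums with polynomial weights *)

Section WeightedSums.
Set Implicit Arguments.
Unset Strict Implicit.
Variables (K : fieldType) (V : vectType K).
Implicit Types (f : int -> V) (c m : int) (p q w : {poly K}) (k n : nat).

(** A polynomial stores the weights: the coefficient of ['X^j] belongs to the index [c + 2 * j], so
    multiplication by ['X] moves the base by 2. *)
Definition wsum f c q : V := \sum_(j < size q) q`_j *: f (c + 2 * j%:Z).

Lemma wsum_widen f c q N : (size q <= N)%N ->
  wsum f c q = \sum_(j < N) q`_j *: f (c + 2 * j%:Z).
Proof.
move=> leN; rewrite /wsum (big_ord_widen N (fun j => q`_j *: f (c + 2 * j%:Z))) //.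
rewrite big_mkcond; apply: eq_bigr => j _; case: ltnP => // le_j.
by rewrite nth_default // scale0r.
Qed.

Lemma wsumD f c p q : wsum f c (p + q) = wsum f c p + wsum f c q.
Proof.
have le_pq := size_polyD p q.
rewrite !(@wsum_widen _ _ _ (maxn (size p) (size q))) ?leq_maxl ?leq_maxr //.
by rewrite -big_split; apply: eq_bigr => j _; rewrite coefD scalerDl.
Qed.

Lemma wsumZ f c a q : wsum f c (a *: q) = a *: wsum f c q.
Proof.
rewrite !(@wsum_widen _ _ _ (size q)) ?size_scale_leq // scaler_sumr.
by apply: eq_bigr => j _; rewrite coefZ scalerA.
Qed.

Lemma wsumN f c q : wsum f c (- q) = - wsum f c q.
Proof. by rewrite -scaleN1r wsumZ scaleN1r. Qed.

Lemma wsum0 f c : wsum f c 0 = 0.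
Proof. by rewrite /wsum size_poly0 big_ord0. Qed.

Lemma wsum_mulX f c q : wsum f c (q * 'X) = wsum f (c + 2) q.
Proof.
have le_q : (size (q * 'X)%R <= (size q).+1)%N.
  by rewrite (leq_trans (size_polyMleq _ _)) // size_polyX addn2.
rewrite (@wsum_widen _ _ _ _ le_q) big_ord_recl coefMX eqxx scale0r add0r.
apply: eq_bigr => j _; rewrite coefMX /= /bump /= add1n.
by congr (_ *: f _); lia.
Qed.

Lemma wsum_Xn f c n : wsum f c 'X^n = f (c + 2 * n%:Z).
Proof.
elim: n c => [|n IHn] c; last first.
  by rewrite exprSr wsum_mulX IHn; congr f; lia.
by rewrite expr0 /wsum size_poly1 big_ord1 coef1 eqxx scale1r.
Qed.

Lemma wsum_diff_mem f (E : {vspace V}) c m q :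
  (forall j, f (m + 2 * j) - f (c + 2 * j) \in E) ->
  wsum f m q - wsum f c q \in E.
Proof.
move=> fE; rewrite /wsum -sumrB; apply: memv_suml => j _.
by rewrite -scalerBr memvZ.
Qed.

(** * Balanced weights and their behaviour under one pentagram step *)

Definition balanced f k c q : Prop :=
  (size q <= k.+1)%N /\
  forall s : nat, (s < k)%N -> wsum f (c + s%:Z) q = wsum f (c + s%:Z + 1) q.

Lemma balanced_comb f k c a b p q :
  balanced f k c p -> balanced f k c q -> balanced f k c (a *: p + b *: q).
Proof.
move=> [szp bp] [szq bq]; split=> [|s lt_sk].
  rewrite (leq_trans (size_polyD _ _)) // geq_max.
  by rewrite !(leq_trans (size_scale_leq _ _)).
by rewrite !wsumD !wsumZ bp ?bq.
Qed.

(** Uniqueness up to a factor belongs to the induction invariant: it lets weights obtained in two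
    different ways be compared. *)
Definition balanced_generator f k c (P : {vspace V}) w : Prop :=
  [/\ balanced f k c w, P = <[wsum f c w]>%VS, wsum f c w != 0
    & forall q, balanced f k c q -> exists a, q = a *: w].

Lemma vlines_independent (u v : V) (a b : K) : u != 0 -> v != 0 ->
  <[u]>%VS <> <[v]>%VS -> a *: u + b *: v = 0 -> a = 0 /\ b = 0.
Proof.
move=> u0 v0 neq_uv /eqP eq0.
have sub_line (x y : V) (d e : K) : d != 0 -> d *: x + e *: y == 0 ->
    (<[x]> <= <[y]>)%VS.
  move=> d0; rewrite addr_eq0 => /eqP eqx; rewrite -memvE.
  by rewrite -[x](scalerK d0) eqx -scaleNr scalerA memvZ ?memv_line.
have eq_lines (x y : V) : x != 0 -> y != 0 -> (<[x]> <= <[y]>)%VS ->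
    <[x]>%VS = <[y]>%VS.
  by move=> x0 y0 le_xy; apply/eqP; rewrite eqEdim le_xy !dim_vline x0 y0.
case: (eqVneq a 0) => [a0|a0]; last first.
  by case: neq_uv; apply: eq_lines => //; exact: sub_line eq0.
move: eq0; rewrite a0 scale0r add0r scaler_eq0 (negbTE v0) orbF => /eqP b0.
by split.
Qed.

(* [w] eliminates the constant coefficient of [q]; the quotient of the rest
   by ['X] is balanced at [c + 2], hence proportional to [w']. *)
Lemma wide_balanced_comb f k c P P' w w' q :
  balanced_generator f k c P w -> balanced_generator f k (c + 2) P' w' ->
  P <> P' -> (size q <= k.+2)%N ->
  (forall s : nat, (s < k)%N -> wsum f (c + s%:Z) q = wsum f (c + s%:Z + 1) q) ->
  exists a b, q = a *: w + b *: (w' * 'X).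
Proof.
move=> [[szw bw] -> nzw _] [_ -> nzw' uniqw'] neqP szq bq.
have div_X p : p`_0 = 0 -> (size p <= k.+2)%N ->
    (forall s : nat, (s < k)%N ->
       wsum f (c + s%:Z) p = wsum f (c + s%:Z + 1) p) ->
    exists b, p = b *: (w' * 'X).
  move=> p0 szp bp.
  have /factor_theorem [r eq_p] : root p 0 by rewrite rootE horner_coef0 p0.
  rewrite subr0 in eq_p.
  have [|b eq_r] := uniqw' r; last by exists b; rewrite eq_p eq_r -scalerAl.
  split=> [|s lt_sk].
    case: (eqVneq r 0) => [->|r0]; first by rewrite size_poly0.
    by move: szp; rewrite eq_p size_mulX.
  have := bp s lt_sk; rewrite eq_p !wsum_mulX.
  have -> : c + s%:Z + 2 = c + 2 + s%:Z by lia.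
  by have -> : c + s%:Z + 1 + 2 = c + 2 + s%:Z + 1 by lia.
(* The constant coefficient of [w] cannot vanish: [w] would be a multiple of [w' * 'X], and the two
   sums would span the same point, against [P <> P']. *)
case: (eqVneq w`_0 0) => [w0|w0].
  have [b eq_w] := div_X w w0 (leqW szw) bw.
  suff [/eqP] : (1 : K) = 0 /\ - b = 0 by rewrite oner_eq0.
  apply: (vlines_independent nzw nzw' neqP).
  by rewrite {1}eq_w wsumZ wsum_mulX scale1r scaleNr subrr.
have [||s lt_sk|b eq_q] := div_X (q - (q`_0 / w`_0) *: w).
- by rewrite coefB coefZ divfK // subrr.
- rewrite (leq_trans (size_polyD _ _)) // geq_max szq size_polyN.
  by rewrite (leq_trans (size_scale_leq _ _)) // leqW.
- by rewrite !wsumD !wsumN !wsumZ bq ?bw.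
by exists (q`_0 / w`_0), b; rewrite -eq_q addrC subrK.
Qed.

Lemma line_of_mem (P : {vspace V}) v : (\dim P <= 1)%N -> v != 0 -> v \in P ->
  P = <[v]>%VS.
Proof.
by move=> dimP v0 vP; apply/eqP; rewrite eq_sym eqEdim -memvE vP dim_vline v0.
Qed.

Lemma exists_vanishing_comb (E : {vspace V}) (u v : V) : (\dim E <= 1)%N ->
  u \in E -> v \in E ->
  exists a b, (a != 0) || (b != 0) /\ a *: u + b *: v = 0.
Proof.
move=> dimE uE vE; case: (eqVneq u 0) => [->|u0].
  by exists 1, 0; rewrite oner_eq0 scaler0 scale0r addr0.
move: vE; rewrite (line_of_mem dimE u0 uE) => /vlineP[d ->].
by exists (- d), 1; rewrite oner_eq0 orbT scale1r scaleNr addNr.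
Qed.

Lemma dim_cap_lines (L M : {vspace V}) :
  (\dim L <= 2)%N -> (\dim M <= 2)%N -> L <> M -> (\dim (L :&: M) <= 1)%N.
Proof.
move=> dimL dimM neqLM; rewrite leqNgt; apply/negP => lt1.
have eqL : (L :&: M)%VS = L.
  by apply/eqP; rewrite eqEdim capvSl (leq_trans dimL).
have eqM : (L :&: M)%VS = M.
  by apply/eqP; rewrite eqEdim capvSr (leq_trans dimM).
by apply: neqLM; rewrite -eqL.
Qed.

Lemma dim_add_vlines (u v : V) : (\dim (<[u]> + <[v]>) <= 2)%N.
Proof.
rewrite (leq_trans (dimv_add_leqif _ _)) // !dim_vline.
by do 2 case: (_ != 0).
Qed.

(* Weights for a point of the diagonal [P0 + P2] are combinations of [w0] and
   [w2 * 'X]; to be also weights for a point of [P1 + P3], they need only one more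
   equation, which is scalar because [f]'s increments lie on the line [E]. *)
Lemma balanced_generator_meet f (E : int -> {vspace V}) k c P0 P1 P2 P3
    w0 w1 w2 w3 :
  (forall m, (\dim (E m) <= 1)%N) ->
  (forall m j, f (m + 1 + 2 * j) - f (m + 2 * j) \in E m) ->
  balanced_generator f k c P0 w0 -> balanced_generator f k (c + 1) P1 w1 ->
  balanced_generator f k (c + 2) P2 w2 -> balanced_generator f k (c + 3) P3 w3 ->
  P0 <> P2 -> P1 <> P3 -> (P0 + P2)%VS <> (P1 + P3)%VS ->
  exists w, balanced_generator f k.+1 c ((P0 + P2) :&: (P1 + P3))%VS w.
Proof.
move=> dimE fE g0 g1 g2 g3 neq02 neq13 neqL.
have c3 : c + 3 = c + 1 + 2 by lia.
rewrite c3 in g3.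
have span0 q : (size q <= k.+2)%N -> (forall s : nat, (s < k)%N ->
    wsum f (c + s%:Z) q = wsum f (c + s%:Z + 1) q) ->
    exists a b, q = a *: w0 + b *: (w2 * 'X).
  exact: wide_balanced_comb g0 g2 neq02.
have span1 q : (size q <= k.+2)%N -> (forall s : nat, (s < k)%N ->
    wsum f (c + 1 + s%:Z) q = wsum f (c + 1 + s%:Z + 1) q) ->
    exists a b, q = a *: w1 + b *: (w3 * 'X).
  exact: wide_balanced_comb g1 g3 neq13.
move: g0 g1 g2 g3 => [[sz0 b0] e0 nz0 _] [_ e1 nz1 _] [[sz2 b2] e2 nz2 _].
move=> [_ e3 nz3 _].
have indep a b : wsum f c (a *: w0 + b *: (w2 * 'X)) = 0 -> a = 0 /\ b = 0.
  rewrite wsumD !wsumZ wsum_mulX.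
  by apply: vlines_independent => //; rewrite -e0 -e2.
have dimP : (\dim ((P0 + P2) :&: (P1 + P3)) <= 1)%N.
  by apply: dim_cap_lines => //; rewrite ?e0 ?e1 ?e2 ?e3 dim_add_vlines.
have sz2X : (size (w2 * 'X)%R <= k.+2)%N.
  by rewrite (leq_trans (size_polyMleq _ _)) // size_polyX addn2.
(* The first [k] equations put the sum on [P0 + P2]. The equation for [s = 0] moves the base to
   [c + 1], where the last [k] equations put the same vector on [P1 + P3]. *)
have inP q : balanced f k.+1 c q -> wsum f c q \in ((P0 + P2) :&: (P1 + P3))%VS.
  move=> [szq bq]; rewrite memv_cap; apply/andP; split.
    have [|a [b ->]] := span0 q szq; first by move=> s lt_sk; apply/bq/ltnW.
    by rewrite wsumD !wsumZ wsum_mulX e0 e2 memv_add ?memvZ ?memv_line.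
  have := bq 0%N isT; rewrite addr0 => ->.
  have [s lt_sk|a [b ->]] := span1 q szq.
    have -> : c + 1 + s%:Z = c + s.+1%:Z by lia.
    exact: bq.
  by rewrite wsumD !wsumZ wsum_mulX e1 e3 memv_add ?memvZ ?memv_line.
(* The defect in the equation for [s = k], the only one that [w0] and [w2 * 'X] may violate. Both
   defects lie in one [E], so some nontrivial combination cancels them. *)
pose d q := wsum f (c + k%:Z + 1) q - wsum f (c + k%:Z) q.
have dE q : d q \in E (c + k%:Z) by apply: wsum_diff_mem => j; exact: fE.
have [a [b [nzab d0]]] := exists_vanishing_comb (dimE _) (dE w0) (dE (w2 * 'X)).
pose w := a *: w0 + b *: (w2 * 'X).
have bal_w : balanced f k.+1 c w.
  split=> [|s].
    rewrite (leq_trans (size_polyD _ _)) // geq_max.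
    by rewrite !(leq_trans (size_scale_leq _ _)) // leqW.
  rewrite ltnS leq_eqVlt => /orP[/eqP->|lt_sk].
    apply/esym/eqP; rewrite -subr_eq0 /w !wsumD !wsumZ opprD addrACA -!scalerBr.
    by apply/eqP.
  rewrite /w !wsumD !wsumZ b0 // !wsum_mulX.
  have -> : c + s%:Z + 2 = c + 2 + s%:Z by lia.
  by rewrite b2 //; congr (_ + _ *: wsum _ _ _); lia.
have nzw : wsum f c w != 0.
  by apply/eqP => /indep[a0 b0']; move: nzab; rewrite a0 b0' eqxx.
exists w; split=> //; first exact: line_of_mem dimP nzw (inP w bal_w).
(* For a suitable [r], the sum of [q - r *: w] at [c] is zero; by [indep], summation at [c] is
   injective on combinations of [w0] and [w2 * 'X]. *)
move=> q bal_q; have := inP q bal_q.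
rewrite (line_of_mem dimP nzw (inP w bal_w)) => /vlineP[r eq_r].
exists r; apply/eqP; rewrite -subr_eq0; apply/eqP.
have [szq bq] : balanced f k.+1 c (1 *: q + (- r) *: w).
  exact: balanced_comb.
rewrite scale1r scaleNr in szq bq *.
have [|a' [b' eq_d]] := span0 _ szq; first by move=> s lt_sk; apply/bq/ltnW.
have [|a0 b0'] := indep a' b'; last by rewrite eq_d a0 b0' !scale0r addr0.
by rewrite -eq_d wsumD wsumN wsumZ eq_r subrr.
Qed.

(* Reducing [q * 'X] modulo ['X^(n.+1) - lam] turns weights based at [c + 2] into weights
   based at [c]. *)
Lemma balanced_rotate f n c lam (C : V) q :
  (forall m, f (m + 2 * n.+1%:Z) = lam *: f m + C) ->
  balanced f n (c + 2) q ->
  balanced f n c (q * 'X - q`_n *: ('X^(n.+1) - lam%:P)) /\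
  wsum f (c + 2) q =
    wsum f c (q * 'X - q`_n *: ('X^(n.+1) - lam%:P)) + q`_n *: C.
Proof.
move=> f_tw [szq bq].
(* The weights ['X^(n.+1) - lam] have sum [C] at every base, so the correction term is the same on
   both sides of each equation. *)
have rot m : wsum f (m + 2) q =
    wsum f m (q * 'X - q`_n *: ('X^(n.+1) - lam%:P)) + q`_n *: C.
  rewrite wsumD wsumN wsumZ wsum_mulX wsumD wsumN wsum_Xn -alg_polyC wsumZ.
  by rewrite -(expr0 'X) wsum_Xn mulr0 addr0 f_tw [_ + C]addrC addrK subrK.
split; last exact: rot.
split=> [|s lt_sn].
  apply/leq_sizeP => j le_nj; rewrite coefB coefZ coefB coefMX coefXn coefC.
  case: j le_nj => //= j; rewrite ltnS eqSS leq_eqVlt => /orP[/eqP->|lt_nj].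
    by rewrite eqxx subr0 mulr1 subrr.
  rewrite gtn_eqF // subr0 mulr0 subr0.
  by rewrite nth_default // (leq_trans szq).
apply: (addIr (q`_n *: C)); rewrite -!rot.
have -> : c + s%:Z + 2 = c + 2 + s%:Z by lia.
by rewrite bq //; congr wsum; lia.
Qed.

(** By uniqueness the rotated weights [w'] are a multiple of [w], so modulo [C] the generators of
    [P'] and [P] are proportional. *)
Lemma balanced_generator_rotate f n c lam (C : V) P P' w w' : lam != 0 ->
  (forall m, f (m + 2 * n.+1%:Z) = lam *: f m + C) ->
  balanced_generator f n c P w -> balanced_generator f n (c + 2) P' w' ->
  (P' + <[C]>)%VS = (P + <[C]>)%VS.
Proof.
move=> lam0 f_tw [_ -> _ uniqw] [bal' -> nzw' _].
have [/uniqw[r eq_r] eq_w'] := balanced_rotate f_tw bal'.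
(* The constant coefficient of the rotated weights is [lam] times the coefficient of [w'] of degree
   [n]. Were [r] zero, the latter would vanish, and so would the sum of [w']. *)
have r0 : r != 0.
  apply/eqP => r0; move: eq_r nzw'; rewrite r0 scale0r => eq0.
  have w'n : w'`_n = 0.
    move/(congr1 (fun p : {poly K} => p`_0)): eq0.
    rewrite coefB coefZ coefB coefMX coefXn coefC /= !sub0r mulrN opprK coef0.
    by move/eqP; rewrite mulf_eq0 (negbTE lam0) orbF => /eqP.
  by rewrite eq_w' eq0 w'n scale0r wsum0 addr0 eqxx.
rewrite eq_r wsumZ in eq_w'.
apply: subv_anti; rewrite !subv_add !addvSr !andbT -!memvE.
apply/andP; split; first by rewrite eq_w' memv_add ?memvZ ?memv_line.
have -> : wsum f c w = r^-1 *: (wsum f (c + 2) w') + (- (r^-1 * w'`_n)) *: C.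
  by rewrite eq_w' scalerDr scalerK // scalerA scaleNr addrK.
by rewrite memv_add ?memvZ ?memv_line.
Qed.

End WeightedSums.

(** * Iterates of the pentagram map and lifts of axis-aligned polygons *)

Section AxisAligned.
Set Implicit Arguments.
Unset Strict Implicit.
Variable R : realType.
Implicit Types (A : int -> {vspace 'rV[R]_3}) (f : int -> 'rV[R]_3).

(** Vertex [i] of the next polygon uses the vertices [i - 1] to [i + 2], so the base drops by one
    per step and the four generators sit at consecutive bases. *)
Lemma iter_pentagram_generator A f (E : int -> {vspace 'rV[R]_3}) k :
  (forall m, (\dim (E m) <= 1)%N) ->
  (forall m j, f (m + 1 + 2 * j) - f (m + 2 * j) \in E m) ->
  (forall i, f i != 0) -> (forall i, A i = <[f i]>%VS) ->
  iter_pentagram_defined k A ->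
  forall i, exists w, balanced_generator f k (i - k%:Z) (iter_pentagram k A i) w.
Proof.
move=> dimE fE nzf eqA; elim: k => [_ i|k IHk def_k i].
  have wsum1 c : wsum f c 1 = f c by rewrite -(expr0 'X) wsum_Xn mulr0 addr0.
  exists 1; rewrite subr0; split; rewrite ?wsum1 //.
    by rewrite /balanced size_poly1.
  by move=> q [/size1_polyC-> _]; exists q`_0; rewrite alg_polyC.
have {}IHk := IHk (fun j lt_jk => def_k j (ltnW lt_jk)).
have [neq02 neq13 neqL] := def_k k (ltnSn k) i.
have [w0] := IHk (i - 1); have [w1] := IHk i.
have [w2] := IHk (i + 1); have [w3] := IHk (i + 2).
have -> : i - 1 - k%:Z = i - k.+1%:Z by lia.
have -> : i - k%:Z = i - k.+1%:Z + 1 by lia.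
have -> : i + 1 - k%:Z = i - k.+1%:Z + 2 by lia.
have -> : i + 2 - k%:Z = i - k.+1%:Z + 3 by lia.
move=> g3 g2 g1 g0.
exact: (balanced_generator_meet dimE fE g0 g1 g2 g3).
Qed.

Definition hvec (x y z : R) : 'rV[R]_3 := \row_(j < 3) [:: x; y; z]`_j.

Lemma hvec_infinityE (v : 'rV[R]_3) : v 0 ord_max = 0 ->
  v = v 0 0 *: hvec 1 0 0 + v 0 1 *: hvec 0 1 0.
Proof.
move=> v2; apply/rowP => -[[|[|[|//]]] lt_j]; rewrite !mxE /=.
- by rewrite mulr1 mulr0 addr0; congr (v _ _); apply: val_inj.
- by rewrite mulr1 mulr0 add0r; congr (v _ _); apply: val_inj.
by rewrite !mulr0 addr0 -v2; congr (v _ _); apply: val_inj.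
Qed.

Lemma normalized_neq0 (v : 'rV[R]_3) : v 0 ord_max = 1 -> v != 0.
Proof. by apply: contra_eq_neq => ->; rewrite mxE eq_sym oner_eq0. Qed.

Lemma mem_line_at_infinity (v : 'rV[R]_3) :
  (v \in line_at_infinity R) = (v 0 ord_max == 0).
Proof.
apply/idP/eqP => [|v2].
  case/memv_addP => _ /vlineP[a ->] [_ /vlineP[b ->] ->].
  by rewrite !mxE /= !mulr0 addr0.
by rewrite [v]hvec_infinityE // memv_add // memvZ // memv_line.
Qed.

Lemma x_axis_at_infinity :
  (meet_point (x_axis R) (line_at_infinity R) <= <[hvec 1 0 0]>)%VS.
Proof.
apply/subvP => v; rewrite memv_cap mem_line_at_infinity => /andP[vx /eqP v2].
have v1 : v 0 1 = 0.
  case/memv_addP: vx => _ /vlineP[a ->] [_ /vlineP[b ->] ->].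
  by rewrite !mxE /= !mulr0 addr0.
by rewrite (hvec_infinityE v2) v1 scale0r addr0 memvZ ?memv_line.
Qed.

Lemma y_axis_at_infinity :
  (meet_point (y_axis R) (line_at_infinity R) <= <[hvec 0 1 0]>)%VS.
Proof.
apply/subvP => v; rewrite memv_cap mem_line_at_infinity => /andP[vy /eqP v2].
have v0 : v 0 0 = 0.
  case/memv_addP: vy => _ /vlineP[a ->] [_ /vlineP[b ->] ->].
  by rewrite !mxE /= !mulr0 addr0.
by rewrite (hvec_infinityE v2) v0 scale0r add0r memvZ ?memv_line.
Qed.

(** With last coordinate 1, differences of lifts are vectors at infinity. *)
Lemma affine_lift A : (forall i, is_affine (A i)) ->
  exists f, forall i, A i = <[f i]>%VS /\ f i 0 ord_max = 1.
Proof.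
move=> affA.
have [|f fA] := @choice _ _ (fun i (v : 'rV[R]_3) =>
    A i = <[v]>%VS /\ v 0 ord_max = 1); last by exists f.
by move=> i; have [x [y ->]] := affA i; exists (hvec x y 1); rewrite mxE.
Qed.

Lemma axis_aligned_sides A f : axis_aligned A ->
  (forall i, A i = <[f i]>%VS /\ f i 0 ord_max = 1) ->
  exists E : int -> {vspace 'rV[R]_3}, (forall m, (\dim (E m) <= 1)%N) /\
    forall m j, f (m + 1 + 2 * j) - f (m + 2 * j) \in E m.
Proof.
move=> [_ _ [e par]] fA.
have side i : f (i + 1) - f i \in
    meet_point (join_line (A i) (A (i + 1))) (line_at_infinity R).
  rewrite memv_cap mem_line_at_infinity !mxE !(fA _).2 subrr eqxx andbT addrC.
  by rewrite memv_add ?memvN // (fA _).1 memv_line.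
(* Adding [2 * j] keeps the parity of [m - e], which decides whether a side is horizontal. *)
exists (fun m => if (2 %| m - e)%Z then <[hvec 1 0 0]>%VS
                 else <[hvec 0 1 0]>%VS).
split=> [m|m j]; first by case: ifP => _; rewrite dim_vline; case: (_ != 0).
have -> : m + 1 + 2 * j = m + 2 * j + 1 by lia.
case: ifP => [/dvdzP[r eq_r]|odd_m].
  have [parx _] := par (r + j); apply: (subvP x_axis_at_infinity).
  rewrite -parx.
  have -> : e + 2 * (r + j) = m + 2 * j by lia.
  exact: side.
have [r eq_r] : exists r, m - e = 2 * r + 1.
  by exists ((m - e) %/ 2)%Z; move: odd_m; lia.
have [_ pary] := par (r + j); apply: (subvP y_axis_at_infinity).
rewrite -pary.
have -> : e + 2 * (r + j) + 2 = m + 2 * j + 1 by lia.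
have -> : e + 2 * (r + j) + 1 = m + 2 * j by lia.
exact: side.
Qed.

(** Every vector at infinity is an eigenvector; the sum of the two basis vectors forces their
    eigenvalues to agree. *)
Lemma fixes_infinity_homothety (phi : 'End('rV[R]_3)) : fixes_infinity phi ->
  exists mu : R, forall v : 'rV[R]_3, v 0 ord_max = 0 -> phi v = mu *: v.
Proof.
move=> fix_phi.
have eigen (v : 'rV[R]_3) : v 0 ord_max = 0 -> exists a, phi v = a *: v.
  move=> v2; case: (eqVneq v 0) => [->|v0].
    by exists 0; rewrite linear0 scaler0.
  have fix_v : (phi @: <[v]>)%VS = <[v]>%VS.
    apply: fix_phi; first by rewrite /is_point dim_vline v0.
    by rewrite -memvE mem_line_at_infinity v2.
  by apply/vlineP; rewrite -fix_v memv_img ?memv_line.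
have [a eq_a] : exists a, phi (hvec 1 0 0) = a *: hvec 1 0 0.
  by apply: eigen; rewrite mxE.
have [b eq_b] : exists b, phi (hvec 0 1 0) = b *: hvec 0 1 0.
  by apply: eigen; rewrite mxE.
have [d eq_d] : exists d,
    phi (hvec 1 0 0 + hvec 0 1 0) = d *: (hvec 1 0 0 + hvec 0 1 0).
  by apply: eigen; rewrite !mxE /= addr0.
move: eq_d; rewrite linearD /= eq_a eq_b => /rowP eq_d.
have := eq_d 0; have := eq_d 1; rewrite !mxE /= !mulr0 !addr0 !add0r !mulr1.
move=> eq_bd eq_ad; exists d => v v2.
rewrite (hvec_infinityE v2) linearD !linearZ /= eq_a eq_b eq_ad eq_bd scalerDr.
by rewrite !scalerA ![d * _]mulrC.
Qed.

(** Differences of lifts are scaled by [mu], so all [phi (f i)] have the same last coordinate [nu];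
    dividing by [nu] restores the normalisation and gives [lam = mu / nu]. *)
Lemma twisted_lift N phi A f : twisted_polygon N phi A -> fixes_infinity phi ->
  (forall i, A i = <[f i]>%VS /\ f i 0 ord_max = 1) ->
  exists2 lam : R, lam != 0 &
    exists C : 'rV[R]_3, forall m : int, f (m + N%:Z) = lam *: f m + C.
Proof.
move=> [_ inj_phi tw] /fixes_infinity_homothety[mu phi_mu] fA.
have phi_f i : phi (f i) = phi (f 0) + mu *: (f i - f 0).
  rewrite -phi_mu; first by rewrite linearB addrC subrK.
  by rewrite !mxE !(fA _).2 subrr.
pose nu := phi (f 0) 0 ord_max.
have nuE i : phi (f i) 0 ord_max = nu.
  by rewrite phi_f !mxE !(fA _).2 subrr mulr0 addr0.
have liftE i : nu *: f (i + N%:Z) = phi (f i).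
  have : phi (f i) \in A (i + N%:Z).
    by rewrite tw memv_img // (fA i).1 memv_line.
  rewrite (fA _).1 => /vlineP[a eq_a].
  by have := nuE i; rewrite eq_a mxE (fA _).2 mulr1 => ->.
have nz_img (v : 'rV[R]_3) : v != 0 -> phi v != 0.
  by apply: contra => phi0; rewrite -memv0 -inj_phi memv_ker.
have nu0 : nu != 0.
  apply: contra (nz_img _ (normalized_neq0 (fA 0).2)) => /eqP nu0.
  by rewrite -liftE nu0 scale0r.
have mu0 : mu != 0.
  have v0 : hvec 1 0 0 != 0.
    by apply/eqP => /rowP/(_ 0)/eqP; rewrite !mxE /= oner_eq0.
  apply: contra (nz_img _ v0) => /eqP mu0.
  by rewrite phi_mu ?mu0 ?scale0r // mxE.
exists (nu^-1 * mu); first by rewrite mulf_neq0 ?invr_eq0.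
exists (nu^-1 *: (phi (f 0) - mu *: f 0)) => m.
rewrite -scalerA -scalerDr -[LHS](scalerK nu0) liftE phi_f scalerBr.
by congr (_ *: _); rewrite addrCA.
Qed.

(** Covers the degenerate case where [C] lies in the vertex it is added to, so that their sum is
    only a point. *)
Lemma exists_line_above (U : {vspace 'rV[R]_3}) : (\dim U <= 2)%N ->
  exists2 L : {vspace 'rV[R]_3}, is_line L & (U <= L)%VS.
Proof.
move=> dimU; pose X := take (2 - \dim U) (vbasis U^C).
have subX : (<<X>> <= U^C)%VS.
  by apply/span_subvP => v /mem_take /vbasis_mem.
have freeX : free X.
  apply: (@catl_free _ _ (drop (2 - \dim U) (vbasis U^C))).
  by rewrite cat_take_drop (basis_free (vbasisP _)).
exists (U + <<X>>)%VS; last exact: addvSl.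
rewrite /is_line dimv_disjoint_sum; last first.
  by apply/eqP; rewrite -subv0 -(capv_compl U) capvS.
rewrite (eqnP freeX) size_take size_tuple dimv_compl dimvf.
have -> : dim 'rV[R]_3 = 3%N by rewrite /dim /= mul1n.
by case: ltnP; lia.
Qed.

End AxisAligned.

Theorem theorem7p9 (R : realType) (n : nat) (phi : 'End('rV[R]_3))
    (A : int -> {vspace 'rV[R]_3}) :
  (0 < n)%N ->
  twisted_polygon (2 * n)%N phi A ->
  axis_aligned A ->
  fixes_infinity phi ->
  iter_pentagram_defined n.-1 A ->
  no_three_consecutive_collinear (iter_pentagram n.-1 A) ->
  forall i0 : int,
    collinear (fun m : int => iter_pentagram n.-1 A (i0 + 2 * m)).
Proof.
case: n => [//|n] _ twA axA fix_phi /= defA _ i0.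
have [f fA] := affine_lift (let: And3 affA _ _ := axA in affA).
have [E [dimE fE]] := axis_aligned_sides axA fA.
have [lam lam0 [C f_tw]] := twisted_lift twA fix_phi fA.
have f_tw' m : f (m + 2 * n.+1%:Z) = lam *: f m + C.
  by rewrite -f_tw; congr f; lia.
have nzf i : f i != 0 by exact: normalized_neq0 (fA i).2.
have gen := iter_pentagram_generator dimE fE nzf (fun i => (fA i).1) defA.
set B := iter_pentagram n A in gen *.
have step (i : int) : (B (i + 2)%R + <[C]>)%VS = (B i + <[C]>)%VS.
  have [w gw] := gen i; have [w' gw'] := gen (i + 2).
  have eq_c : i + 2 - n%:Z = i - n%:Z + 2 by lia.
  rewrite eq_c in gw'.
  exact: balanced_generator_rotate lam0 f_tw' gw gw'.
have stepn (k : nat) (i : int) :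
    (B (i + 2 * k%:Z)%R + <[C]>)%VS = (B i + <[C]>)%VS.
  elim: k => [|k <-]; first by rewrite mulr0 addr0.
  by rewrite -[RHS]step; congr (B _ + _)%VS; lia.
have stepz (m : int) : (B (i0 + 2 * m)%R + <[C]>)%VS = (B i0 + <[C]>)%VS.
  case: m => k; first exact: stepn.
  (* Here [m] is [- (k + 1)], so [k.+1] double steps upwards lead back to [i0]. *)
  by rewrite -[LHS](stepn k.+1); congr (B _ + _)%VS; lia.
have dimU : (\dim (B i0 + <[C]>) <= 2)%N.
  by have [w [_ -> _ _]] := gen i0; exact: dim_add_vlines.
have [L lineL le_L] := exists_line_above dimU.
by exists L => // m; rewrite (subv_trans _ le_L) // -(stepz m) addvSl.
Qed.
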